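(* Let $G_p$ and $G_c$ be IF-OFP systems with passivity indices $(\nu_p,\rho_p)$ and $(\nu_c,\rho_c)$ respectively, interconnected in the controller-side event-triggered feedback loop described in the context, where the triggering instants $t_k$ are determined by the condition $\|e_c(t)\|_2^2>\delta\|y_c(t)\|_2^2$ with $\delta\in(0,1]$, and let $w_2=0$. If $\rho_c\ge\delta$, $\nu_p=0$ and $\rho_p+\nu_c\ge\tfrac14$, then the networked control system is passive from $w_1$ to $y_p$, meaning $$\dot V(t)\le w_1^T(t)y_p(t)$$ for a storage function $V$ of the interconnection.
   Context: Systems: a system $G$ has the form $\dot x=f(x,u)$, $y=h(x,u)$ with state $x\in X\subset\mathbb{R}^n$ and $u(t),y(t)\in\mathbb{R}^m$. A storage function is a nonnegative function $V$ of the state; it is taken differentiable, and $\dot V(t)$ is the time derivative along solutions. $G$ is IF-OFP (input feed-forward output feedback passive) with input passivity index $\nu\in\mathbb{R}$ and output passivity index $\rho\in\mathbb{R}$ (of either sign) if there is a storage function $V$ with $\dot V\le u^Ty-\rho y^Ty-\nu u^Tu$ for all $t$ along all solutions. Controller-side event-triggered loop: $G_p$ (plant, state $x_p$, input $u_p$, output $y_p$) has indices $(\nu_p,\rho_p)$, and $G_c$ (controller, state $x_c$, input $u_c$, output $y_c$) has indices $(\nu_c,\rho_c)$; all inputs and outputs are $\mathbb{R}^m$-valued. External signals $w_1,w_2$ are $\mathbb{R}^m$-valued. At event instants $t_k$ the controller output is sampled and sent to the plant, and is held constant until the next event. For $t\in[t_k,t_{k+1})$: $u_c(t)=w_2(t)+y_p(t)$,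 $u_p(t)=w_1(t)-y_c(t_k)$, $e_c(t)=y_c(t)-y_c(t_k)$ (so $u_p=w_1+e_c-y_c$). A new event is triggered as soon as $\|e_c(t)\|_2^2>\delta\|y_c(t)\|_2^2$ (Euclidean norm of the vectors at time $t$), so that $e_c^T(t)e_c(t)\le\delta\, y_c^T(t)y_c(t)$ holds at all times. A storage function of the interconnection is a nonnegative function $V$ of $(x_p,x_c)$; inequalities on $\dot V$ are required along all solutions for all $t$ in the intervals $[t_k,t_{k+1})$. *)

(* Defs.v *)
From mathcomp Require Export all_boot all_order all_algebra.
From mathcomp Require Export all_classical all_reals all_analysis.

Set Implicit Arguments.
Unset Strict Implicit.
Unset Printing Implicit Defensive.

Import Order.TTheory GRing.Theory Num.Theory.
Import numFieldNormedType.Exports.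

Local Open Scope classical_set_scope.
Local Open Scope ring_scope.

Definition dotv (R : realType) (m : nat) (u v : 'cV[R]_m) : R :=
  (u^T *m v) 0 0.

(* The library norm on 'cV[R]_m is the sup norm. *)
Definition norm2 (R : realType) (m : nat) (u : 'cV[R]_m) : R :=
  Num.sqrt (dotv u u).

(* [a, b), where b may be +oo *)
Definition hco (R : realType) (a : R) (b : \bar R) : set R :=
  [set t : R | (a%:E <= t%:E)%E /\ (t%:E < b)%E].

(* Inputs may jump (the sampled one does at event instants), so time
   derivatives are taken from the right; wherever the two-sided derivative
   exists, this is the same number. *)
Definition has_time_derivative (R : realType) (W : normedModType R)
    (g : R -> W) (t : R) (d : W) : Prop :=
  h^-1 *: (g (t + h) - g t) @[h --> 0^'+] --> d.

(* x' = f(x, u), y = h(x, u), with state space sys_X *)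
Record system (R : realType) (n m : nat) := System {
  sys_X : set 'cV[R]_n ;
  sys_f : 'cV[R]_n -> 'cV[R]_m -> 'cV[R]_n ;
  sys_h : 'cV[R]_n -> 'cV[R]_m -> 'cV[R]_m }.

Definition solution (R : realType) (n m : nat) (G : system R n m)
    (a : R) (b : \bar R) (x : R -> 'cV[R]_n) (u y : R -> 'cV[R]_m) : Prop :=
  {within hco a b, continuous x} /\
  forall t, hco a b t ->
    [/\ sys_X G (x t),
        has_time_derivative x t (sys_f G (x t) (u t))
      & y t = sys_h G (x t) (u t)].

Definition storage_function (R : realType) (W : normedModType R)
    (X : set W) (V : W -> R) : Prop :=
  forall x, X x -> 0 <= V x /\ differentiable V x.

(* d/dt V(x(t)) exists at time t and is at most s *)
Definition Vdot_le (R : realType) (W : normedModType R)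
    (V : W -> R) (x : R -> W) (t s : R) : Prop :=
  exists2 dV : R, has_time_derivative (V \o x : R -> R^o) t dV & dV <= s.

(* nu : input passivity index; rho : output passivity index *)
Definition IF_OFP (R : realType) (n m : nat) (G : system R n m)
    (nu rho : R) : Prop :=
  exists V : 'cV[R]_n -> R,
    storage_function (sys_X G) V /\
    forall (a : R) (b : \bar R) (x : R -> 'cV[R]_n) (u y : R -> 'cV[R]_m),
      solution G a b x u y ->
      forall t, hco a b t ->
        Vdot_le V x t (dotv (u t) (y t) - rho * dotv (y t) (y t)
                       - nu * dotv (u t) (u t)).

Record loop_signals (R : realType) (np nc m : nat) := LoopSignals {
  xp : R -> 'cV[R]_np ; up : R -> 'cV[R]_m ; yp : R -> 'cV[R]_m ;
  xc : R -> 'cV[R]_nc ; uc : R -> 'cV[R]_m ; yc : R -> 'cV[R]_m }.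

(* The loop on [a, b) while the controller output sampled at time a is held. *)
Definition held_loop (R : realType) (np nc m : nat)
    (Gp : system R np m) (Gc : system R nc m) (w1 w2 : R -> 'cV[R]_m)
    (a : R) (b : \bar R) (z : loop_signals R np nc m) : Prop :=
  [/\ solution Gp a b (xp z) (up z) (yp z),
      solution Gc a b (xc z) (uc z) (yc z)
    & forall t, hco a b t ->
        uc z t = w2 t + yp z t /\ up z t = w1 t - yc z a].

Definition ec (R : realType) (np nc m : nat) (z : loop_signals R np nc m)
    (a t : R) : 'cV[R]_m :=
  yc z t - yc z a.

(* +oo if the triggering condition is never met on [a, b) *)
Definition next_event (R : realType) (np nc m : nat) (delta : R)
    (a : R) (b : \bar R) (z : loop_signals R np nc m) : \bar R :=
  ereal_inf [set t%:E | t in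
    [set t | hco a b t /\ norm2 (ec z a t) ^+ 2 > delta * norm2 (yc z t) ^+ 2]].

(* Executions of the controller-side event-triggered loop.  [tk k] is the k-th
   event instant; [tk k = +oo] means that it does not occur.
   [z k] is the motion that starts at [tk k] and holds the sample taken there.
   It is followed up to [b k], past [tk k.+1], because "as soon as" the strict
   triggering condition holds is an infimum of times at which the old sample
   is still held.  Only on [tk k, tk k.+1) are the signals of [z k] those of
   the loop.  If [tk k.+1 = +oo], a finite [b k] allows for solutions that do
   not exist for all time. *)
Definition event_triggered_loop (R : realType) (np nc m : nat)
    (Gp : system R np m) (Gc : system R nc m) (delta : R)
    (w1 w2 : R -> 'cV[R]_m) (tk b : nat -> \bar R)
    (z : nat -> loop_signals R np nc m) : Prop :=
  tk 0%N \is a fin_num /\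
  (forall k, tk k = +oo%E -> tk k.+1 = +oo%E) /\
  forall (k : nat) (a : R), tk k = a%:E ->
    [/\ (a%:E < b k)%E,
        held_loop Gp Gc w1 w2 a (b k) (z k),
        tk k.+1 = next_event delta a (b k) (z k)
      & forall a' : R, tk k.+1 = a'%:E ->
          xp (z k.+1) a' = xp (z k) a' /\ xc (z k.+1) a' = xc (z k) a'].

(* Main.v *)
Require Import Defs.
From mathcomp Require Import all_boot all_order all_algebra.
From mathcomp Require Import all_classical all_reals all_analysis.
From mathcomp Require Import lra.
Import Order.TTheory GRing.Theory Num.Theory.
Import numFieldNormedType.Exports.
Local Open Scope classical_set_scope.
Local Open Scope ring_scope.

(** The storage function of the loop is the sum of the two given ones, with
    plant state and controller state as separate variables.  On an interval
    between events its derivative is at most the sum of the two supply rates.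
    With [w2 = 0] and [nup = 0], writing [up = w1 + ec - yc] and [uc = yp], the
    cross terms [- yc . yp] and [yp . yc] cancel, as in any negative feedback
    loop, and the sum of the supply rates is

      [w1 . yp + ec . yp - (rhop + nuc) |yp|^2 - rhoc |yc|^2].

    The only term of the wrong kind is the sampling error's [ec . yp].  It is
    at most [|ec|^2 + |yp|^2 / 4] ([dotv_young]).  Before the next event
    [|ec|^2 <= delta |yc|^2] ([before_next_event]), which [rhoc >= delta]
    absorbs, while [rhop + nuc >= 1/4] absorbs [|yp|^2 / 4]
    ([event_triggered_supply_le]).  The remaining lemmas,
    [storage_function_add] and [Vdot_le_add], say that storage functions and
    dissipation inequalities may be added. *)

Lemma dotv_sum {R : realType} {m : nat} (u v : 'cV[R]_m) :
  dotv u v = \sum_i u i 0 * v i 0.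
Proof. by rewrite /dotv mxE; apply: eq_bigr => i _; rewrite mxE. Qed.

Lemma dotvC {R : realType} {m : nat} (u v : 'cV[R]_m) : dotv u v = dotv v u.
Proof. by rewrite !dotv_sum; apply: eq_bigr => i _; rewrite mulrC. Qed.

Lemma dotvDl {R : realType} {m : nat} (u v w : 'cV[R]_m) :
  dotv (u + v) w = dotv u w + dotv v w.
Proof. by rewrite /dotv linearD mulmxDl mxE. Qed.

Lemma dotvBl {R : realType} {m : nat} (u v w : 'cV[R]_m) :
  dotv (u - v) w = dotv u w - dotv v w.
Proof. by rewrite /dotv linearB mulmxBl !mxE. Qed.

Lemma dotvv_ge0 {R : realType} {m : nat} (u : 'cV[R]_m) : 0 <= dotv u u.
Proof. by rewrite dotv_sum; apply: sumr_ge0 => i _; rewrite -expr2 sqr_ge0. Qed.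

Lemma norm2_sqr {R : realType} {m : nat} (u : 'cV[R]_m) :
  norm2 u ^+ 2 = dotv u u.
Proof. by rewrite /norm2 sqr_sqrtr ?dotvv_ge0. Qed.

(** This is [|u - v / 2|^2 >= 0].  Of the weights that Young's inequality
    allows, these give the error [u] weight 1, which leaves exactly [delta] for
    [rhoc] to absorb, and the plant output [v] the weight [1/4] required of
    [rhop + nuc]. *)
Lemma dotv_young {R : realType} {m : nat} (u v : 'cV[R]_m) :
  dotv u v <= dotv u u + 4^-1 * dotv v v.
Proof.
rewrite !dotv_sum mulr_sumr -big_split; apply: ler_sum => i _ /=.
have := sqr_ge0 (u i 0 - 2^-1 * v i 0); nra.
Qed.

(** The next event is the infimum of the times at which the triggering
    condition holds, so a time strictly before it cannot be one of them. *)
Lemma before_next_event {R : realType} {np nc m : nat} {delta a : R}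
    {b : \bar R} {z : loop_signals R np nc m} {t : R} :
  hco a b t -> (t%:E < next_event delta a b z)%E ->
  dotv (ec z a t) (ec z a t) <= delta * dotv (yc z t) (yc z t).
Proof.
move=> tab tnext; rewrite leNgt; apply/negP => trig.
move: tnext; rewrite ltNge => /negP; apply.
by apply: ereal_inf_lbound; exists t => //; split => //; rewrite !norm2_sqr.
Qed.

Lemma storage_function_add {R : realType} {W1 W2 : normedModType R}
    (X1 : set W1) (X2 : set W2) (V1 : W1 -> R) (V2 : W2 -> R) :
  storage_function X1 V1 -> storage_function X2 V2 ->
  storage_function (X1 `*` X2) (fun p => V1 p.1 + V2 p.2).
Proof.
move=> sV1 sV2 [x1 x2] [/= /sV1[V1_ge0 dV1] /sV2[V2_ge0 dV2]].
split; first exact: addr_ge0.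
apply: (@differentiableD _ _ _ (V1 \o fst) (V2 \o snd)).
- apply: differentiable_comp => //.
  by apply: linear_differentiable => p; exact: cvg_fst.
- apply: differentiable_comp => //.
  by apply: linear_differentiable => p; exact: cvg_snd.
Qed.

Lemma Vdot_le_add {R : realType} {W1 W2 : normedModType R}
    {V1 : W1 -> R} {V2 : W2 -> R} {x1 : R -> W1} {x2 : R -> W2} {t s1 s2 : R} :
  Vdot_le V1 x1 t s1 -> Vdot_le V2 x2 t s2 ->
  Vdot_le (fun p => V1 p.1 + V2 p.2) (fun s => (x1 s, x2 s)) t (s1 + s2).
Proof.
move=> [d1 cd1 le1] [d2 cd2 le2]; exists (d1 + d2); last exact: lerD.
rewrite /has_time_derivative.
under eq_fun do rewrite /= opprD addrACA scalerDr.
exact: cvgD cd1 cd2.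
Qed.

(** The algebraic core, at one instant: [w] is the external input, [e] the
    sampling error, [y] the plant output and [v] the controller output. *)
Lemma event_triggered_supply_le {R : realType} {m : nat}
    {w e y v : 'cV[R]_m} {rhop nuc rhoc delta : R} :
  dotv e e <= delta * dotv v v -> delta <= rhoc -> 4^-1 <= rhop + nuc ->
  (dotv (w + e - v) y - rhop * dotv y y) +
    (dotv y v - rhoc * dotv v v - nuc * dotv y y) <= dotv w y.
Proof.
move=> he hrho hsum; rewrite dotvBl dotvDl (dotvC y v).
have young := dotv_young e y.
have := ler_wpM2r (dotvv_ge0 v) hrho.
have := ler_wpM2r (dotvv_ge0 y) hsum.
lra.
Qed.

Theorem theorem8 (R : realType) (np nc m : nat)
    (Gp : system R np m) (Gc : system R nc m)
    (nup rhop nuc rhoc delta : R)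
    (hGp : IF_OFP Gp nup rhop) (hGc : IF_OFP Gc nuc rhoc)
    (hdelta : 0 < delta <= 1)
    (hrhoc : delta <= rhoc) (hnup : nup = 0) (hsum : 4^-1 <= rhop + nuc) :
  exists V : 'cV[R]_np * 'cV[R]_nc -> R,
    storage_function (sys_X Gp `*` sys_X Gc) V /\
    forall (w1 w2 : R -> 'cV[R]_m), (forall t, w2 t = 0) ->
    forall (tk b : nat -> \bar R) (z : nat -> loop_signals R np nc m),
      event_triggered_loop Gp Gc delta w1 w2 tk b z ->
      forall (k : nat) (a t : R), tk k = a%:E ->
        hco a (tk k.+1) t -> (t%:E < b k)%E ->
        Vdot_le V (fun s => (xp (z k) s, xc (z k) s)) t
          (dotv (w1 t) (yp (z k) t)).
Proof.
have [Vp [sVp dVp]] := hGp; have [Vc [sVc dVc]] := hGc.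
exists (fun p => Vp p.1 + Vc p.2); split; first exact: storage_function_add.
move=> w1 w2 w20 tk b z [_ [_ loop]] k a t tka [at_ tnext] tb.
have [_ [solp solc inputs] tkS _] := loop k a tka.
have tab : hco a (b k) t by [].
have [uc_t up_t] := inputs t tab.
have [d dV d_le] :=
  Vdot_le_add (dVp _ _ _ _ _ solp t tab) (dVc _ _ _ _ _ solc t tab).
exists d => //; apply: (le_trans d_le).
rewrite hnup mul0r subr0 uc_t w20 add0r.
(* The plant receives the current controller output up to the error [ec]. *)
have -> : up (z k) t = w1 t + ec (z k) a t - yc (z k) t.
  by rewrite up_t /ec addrA addrAC addrK.
apply: (event_triggered_supply_le _ hrhoc hsum).
by apply: (before_next_event tab); rewrite -tkS.
Qed.
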